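(* Let $p$ be a prime, $R=\mathbb{Z}_p[u,v]$, $\alpha,\beta\ge1$ integers, and let $\mathcal{C}$ be a $\mathbb{Z}_p\mathbb{Z}_p[u,v]$-additive cyclic code of length $(\alpha,\beta)$, regarded as an $R[x]$-submodule of $R_{\alpha,\beta}$. All polynomials $f_i,g,a,b,p_i$ below are in $\mathbb{Z}_p[x]$. 1. If $\beta$ is not relatively prime to $p$, then $\mathcal{C}$ has one of the following forms: (a) $\mathcal{C}=\langle (f_1,0),(f_2,g+up_1+vp_2),(f_3,ua+vp_3),(f_4,vb)\rangle$, where $a\mid g\mid(x^\beta-1)$, $b\mid g\mid(x^\beta-1)$, $f_1\mid(x^\alpha-1)$ and $f_i\in\mathbb{Z}_p[x]$ for $i=2,3,4$; or (b) $\mathcal{C}=\langle (f_1,0),(f_2,g+up_1+vp_2)\rangle$, where $(g+up_1+vp_2)\mid(x^\beta-1)$ in $R[x]$, $f_1\mid(x^\alpha-1)$ and $f_1,f_2\in\mathbb{Z}_p[x]$. 2. If $\beta$ is relatively prime to $p$, then $\mathcal{C}=\langle (f_1,0),(f_2,g+ua+vp_1),(f_3,vb)\rangle$, where $a\mid g\mid(x^\beta-1)$, $b\mid g\mid(x^\beta-1)$, $f_1\mid(x^\alpha-1)$ and $f_i\in\mathbb{Z}_p[x]$ for $i=2,3$.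
   Context: $R=\mathbb{Z}_p[u,v]$ denotes the ring $\mathbb{Z}_p+u\mathbb{Z}_p+v\mathbb{Z}_p$ with $u^2=v^2=uv=vu=0$. $\rho:R\to\mathbb{Z}_p$, $\rho(a+ub+vc)=a$, extended coefficientwise to $R[x]\to\mathbb{Z}_p[x]$. $R_{\alpha,\beta}=\mathbb{Z}_p[x]/\langle x^\alpha-1\rangle\times R[x]/\langle x^\beta-1\rangle$ is an $R[x]$-module via $\gamma(x)*(c(x),d(x))=(\rho(\gamma(x))c(x),\gamma(x)d(x))$. A $\mathbb{Z}_p\mathbb{Z}_p[u,v]$-additive code of length $(\alpha,\beta)$ is an $R$-submodule of $\mathbb{Z}_p^\alpha\times R^\beta$ (with $z*(c,d)=(\rho(z)c,zd)$); it is additive cyclic if it is closed under $(c_0,\dots,c_{\alpha-1},d_0,\dots,d_{\beta-1})\mapsto(c_{\alpha-1},c_0,\dots,c_{\alpha-2},d_{\beta-1},d_0,\dots,d_{\beta-2})$. Identifying words with pairs of polynomials $(\sum c_ix^i,\sum d_ix^i)$, additive cyclic codes are the $R[x]$-submodules of $R_{\alpha,\beta}$. $\langle\cdot\rangle$ is the $R[x]$-submodule generated. *)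

(* Defs.v *)
From HB Require Import structures.
From mathcomp Require Import all_boot all_order all_algebra.
Set Implicit Arguments.
Unset Strict Implicit.
Unset Printing Implicit Defensive.
Import GRing.Theory.
Local Open Scope ring_scope.

(* [Ruv F] is F + uF + vF with u^2 = v^2 = uv = vu = 0; the element
   a + ub + vc is [MkRuv a b c]. *)
Record Ruv (F : Type) : Type := MkRuv {rho : F; ucoef : F; vcoef : F}.

Definition Ruv_tuple (F : Type) (x : Ruv F) : F * F * F :=
  (rho x, ucoef x, vcoef x).
Definition tuple_Ruv (F : Type) (t : F * F * F) : Ruv F :=
  MkRuv t.1.1 t.1.2 t.2.
Lemma Ruv_tupleK (F : Type) : cancel (@Ruv_tuple F) (@tuple_Ruv F).
Proof. by case. Qed.

HB.instance Definition _ (F : eqType) :=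
  Equality.copy (Ruv F) (can_type (@Ruv_tupleK F)).
HB.instance Definition _ (F : choiceType) :=
  Choice.copy (Ruv F) (can_type (@Ruv_tupleK F)).
HB.instance Definition _ (F : countType) :=
  Countable.copy (Ruv F) (can_type (@Ruv_tupleK F)).
HB.instance Definition _ (F : finType) :=
  Finite.copy (Ruv F) (can_type (@Ruv_tupleK F)).

Section RuvZmodule.
Variable F : zmodType.
Implicit Types x y : Ruv F.

Definition Ruv_zero : Ruv F := MkRuv 0 0 0.
Definition Ruv_opp x := MkRuv (- rho x) (- ucoef x) (- vcoef x).
Definition Ruv_add x y :=
  MkRuv (rho x + rho y) (ucoef x + ucoef y) (vcoef x + vcoef y).

Fact Ruv_addA : associative Ruv_add.
Proof. by move=> x y z; rewrite /Ruv_add /= !addrA. Qed.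
Fact Ruv_addC : commutative Ruv_add.
Proof.
by move=> x y; congr MkRuv; rewrite addrC.
Qed.
Fact Ruv_add0 : left_id Ruv_zero Ruv_add.
Proof. by case=> a b c; rewrite /Ruv_add /= !add0r. Qed.
Fact Ruv_addN : left_inverse Ruv_zero Ruv_opp Ruv_add.
Proof. by move=> x; rewrite /Ruv_add /= !addNr. Qed.

HB.instance Definition _ :=
  GRing.isZmodule.Build (Ruv F) Ruv_addA Ruv_addC Ruv_add0 Ruv_addN.
End RuvZmodule.

Section RuvRing.
Variable F : comNzRingType.
Implicit Types x y : Ruv F.

Definition Ruv_one : Ruv F := MkRuv 1 0 0.
Definition Ruv_mul x y :=
  MkRuv (rho x * rho y)
        (rho x * ucoef y + ucoef x * rho y)
        (rho x * vcoef y + vcoef x * rho y).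

Fact Ruv_mulA : associative Ruv_mul.
Proof.
by move=> x y z; rewrite /Ruv_mul /= !mulrDr !mulrDl !mulrA !addrA.
Qed.
Fact Ruv_mulC : commutative Ruv_mul.
Proof.
move=> x y; congr MkRuv; first exact: mulrC.
  by rewrite addrC; congr (_ + _); rewrite mulrC.
by rewrite addrC; congr (_ + _); rewrite mulrC.
Qed.
Fact Ruv_mul1 : left_id Ruv_one Ruv_mul.
Proof. by case=> a b c; rewrite /Ruv_mul /= !mul1r !mul0r !addr0. Qed.
Fact Ruv_mulDl : left_distributive Ruv_mul +%R.
Proof.
by move=> x y z; congr MkRuv; rewrite /= ?mulrDl // addrACA.
Qed.
Fact Ruv_one_neq0 : Ruv_one != 0.
Proof. by apply/eqP=> -[] /eqP; rewrite oner_eq0. Qed.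

HB.instance Definition _ :=
  GRing.Zmodule_isComNzRing.Build (Ruv F)
    Ruv_mulA Ruv_mulC Ruv_mul1 Ruv_mulDl Ruv_one_neq0.

Definition Ru : Ruv F := MkRuv 0 1 0.
Definition Rv : Ruv F := MkRuv 0 0 1.

Fact rho_is_zmod_morphism : zmod_morphism (@rho F). Proof. by []. Qed.
Fact rho_is_monoid_morphism : monoid_morphism (@rho F). Proof. by []. Qed.
HB.instance Definition _ :=
  GRing.isZmodMorphism.Build (Ruv F) F (@rho F) rho_is_zmod_morphism.
HB.instance Definition _ :=
  GRing.isMonoidMorphism.Build (Ruv F) F (@rho F) rho_is_monoid_morphism.

Definition Ruv_const (a : F) : Ruv F := MkRuv a 0 0.

Fact Ruv_const_is_zmod_morphism : zmod_morphism Ruv_const.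
Proof. by move=> a b; congr MkRuv; rewrite /= subr0. Qed.
Fact Ruv_const_is_monoid_morphism : monoid_morphism Ruv_const.
Proof.
by split=> // a b; congr MkRuv; rewrite /= mulr0 mul0r addr0.
Qed.
HB.instance Definition _ :=
  GRing.isZmodMorphism.Build F (Ruv F) Ruv_const Ruv_const_is_zmod_morphism.
HB.instance Definition _ :=
  GRing.isMonoidMorphism.Build F (Ruv F) Ruv_const
    Ruv_const_is_monoid_morphism.

Definition polyR (q : {poly F}) : {poly Ruv F} := map_poly Ruv_const q.

Lemma RuvE (a b c : F) :
  MkRuv a b c = Ruv_const a + Ru * Ruv_const b + Rv * Ruv_const c.
Proof.
by congr MkRuv; rewrite /= ?mul0r ?mul1r ?mulr0 ?addr0 ?add0r.
Qed.
Lemma Ru_sqr : Ru * Ru = 0.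
Proof. by congr MkRuv; rewrite /= ?mul0r ?mulr0 ?addr0. Qed.
Lemma Rv_sqr : Rv * Rv = 0.
Proof. by congr MkRuv; rewrite /= ?mul0r ?mulr0 ?addr0. Qed.
Lemma Ru_Rv : Ru * Rv = 0.
Proof. by congr MkRuv; rewrite /= ?mul0r ?mulr0 ?addr0. Qed.
End RuvRing.
Arguments Ru {F}.
Arguments Rv {F}.

(* For p prime, ['F_p] is the ring of integers mod p.  R acts on the first
   block through rho, so the scaling below is not the library's product one. *)
Definition word (p alpha beta : nat) : Type :=
  ('rV['F_p]_alpha * 'rV[Ruv 'F_p]_beta)%type.

Section Words.
Variables p alpha beta : nat.
Local Notation word := (word p alpha beta).

HB.instance Definition _ := Finite.on word.
HB.instance Definition _ := GRing.Zmodule.on word.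

Definition word_scale (z : Ruv 'F_p) (w : word) : word :=
  (rho z *: w.1, z *: w.2).

Fact word_scaleA a b w :
  word_scale a (word_scale b w) = word_scale (a * b) w.
Proof. by rewrite /word_scale /= !scalerA. Qed.
Fact word_scale1 : left_id 1 word_scale.
Proof. by case=> c d; rewrite /word_scale /= !scale1r. Qed.
Fact word_scaleDr : right_distributive word_scale +%R.
Proof. by move=> a w1 w2; rewrite /word_scale /= !scalerDr. Qed.
Fact word_scaleDl w : {morph word_scale^~ w : a b / a + b}.
Proof. by move=> a b; rewrite /word_scale /= !scalerDl. Qed.

HB.instance Definition _ := GRing.Zmodule_isLmodule.Build (Ruv 'F_p) word
  word_scaleA word_scale1 word_scaleDr word_scaleDl.

(* [ord_pred j] is j - 1 modulo the length. *)
Definition shift (w : word) : word :=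
  (\row_j w.1 0 (ord_pred j), \row_j w.2 0 (ord_pred j)).

Definition additive_code (C : {set word}) : Prop := submod_closed C.

Definition additive_cyclic (C : {set word}) : Prop :=
  additive_code C /\ {in C, forall w, shift w \in C}.
End Words.

(* R_{alpha,beta}.  The library's quotient [{poly %/ h}] is the intended one
   when h is monic and nonconstant; for h = 'X^n - 1 this means 0 < n. *)
Definition Rab (p alpha beta : nat) : Type :=
  ({poly %/ ('X^alpha - 1 : {poly 'F_p})} *
   {poly %/ ('X^beta - 1 : {poly Ruv 'F_p})})%type.

Section RabModule.
Variables p alpha beta : nat.
Local Notation Rab := (Rab p alpha beta).

HB.instance Definition _ := GRing.Zmodule.on Rab.

Definition inRab (c : {poly 'F_p}) (d : {poly Ruv 'F_p}) : Rab :=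
  (in_qpoly ('X^alpha - 1) c, in_qpoly ('X^beta - 1) d).

Definition Rab_scale (gamma : {poly Ruv 'F_p}) (m : Rab) : Rab :=
  (in_qpoly ('X^alpha - 1) (map_poly (@rho 'F_p) gamma) * m.1,
   in_qpoly ('X^beta - 1) gamma * m.2).

Fact Rab_scaleA a b m : Rab_scale a (Rab_scale b m) = Rab_scale (a * b) m.
Proof. by rewrite /Rab_scale /= !rmorphM /= !mulrA. Qed.
Fact Rab_scale1 : left_id 1 Rab_scale.
Proof. by case=> c d; rewrite /Rab_scale /= !rmorph1 !mul1r. Qed.
Fact Rab_scaleDr : right_distributive Rab_scale +%R.
Proof. by move=> a m1 m2; rewrite /Rab_scale /= !mulrDr. Qed.
Fact Rab_scaleDl m : {morph Rab_scale^~ m : a b / a + b}.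
Proof. by move=> a b; rewrite /Rab_scale /= !rmorphD /= !mulrDl. Qed.

HB.instance Definition _ :=
  GRing.Zmodule_isLmodule.Build {poly Ruv 'F_p} Rab
    Rab_scaleA Rab_scale1 Rab_scaleDr Rab_scaleDl.

(* The identification of words with pairs of polynomials. *)
Definition word_poly (w : word p alpha beta) : Rab :=
  inRab (rVpoly w.1) (rVpoly w.2).
End RabModule.
Arguments inRab {p} alpha beta c d.

Definition in_span (S : nzRingType) (V : lmodType S) (gs : seq V) (m : V) :
    Prop :=
  exists c : 'I_(size gs) -> S, m = \sum_(i < size gs) c i *: gs`_i.

(* C = <gs>, where C is regarded as a subset of R_{alpha,beta}. *)
Definition generated_by (p alpha beta : nat)
    (C : {set word p alpha beta}) (gs : seq (Rab p alpha beta)) : Prop :=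
  forall m : Rab p alpha beta,
    (exists2 w, w \in C & m = word_poly w) <-> in_span gs m.

(* Main.v *)
(* A submodule N is filtered by its elements (c, d) with d = 0 mod (u, v), then
   those with d a multiple of v, then those with d = 0.  On each layer the
   leading coefficients form an ideal of Z_p[x] containing x^n - 1 for n = beta
   (n = alpha on the last layer), hence consist of the multiples of a divisor of
   x^n - 1: this yields g, a, b, f1, and an element of N above each of them.
   Multiplying by u or v moves g down a layer, whence a | g and b | g.  These four
   elements generate N, so form (a) is always available.
   If beta is prime to p then x^beta - 1 = s g with s, g coprime, and then the
   element g + uy + vz generates both g and uy + vz modulo x^beta - 1.  Hence
   g lies in the projection of N, and a preimage of it merges with
   (f3, ua + vp3) into one generator with second component g + ua + vp3. *)
From Stdlib Require Import Classical.
Require Import Defs.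
From mathcomp Require Import all_boot all_order all_algebra.
From mathcomp Require Import separable cyclotomic ring.
Set Implicit Arguments.
Unset Strict Implicit.
Unset Printing Implicit Defensive.
Import GRing.Theory.
Local Open Scope ring_scope.

(** * Polynomials over [Ruv F] by components *)

Definition uvpoly (F : comNzRingType) (a b c : {poly F}) : {poly Ruv F} :=
  polyR a + Ru *: polyR b + Rv *: polyR c.

Lemma coef_uvpoly (F : comNzRingType) (a b c : {poly F}) i :
  (uvpoly a b c)`_i = MkRuv a`_i b`_i c`_i.
Proof. by rewrite RuvE !coefD !coefZ !coef_map. Qed.

Lemma uvpoly_surj (F : comNzRingType) (d : {poly Ruv F}) :
  exists a b c, d = uvpoly a b c.
Proof.
exists (\poly_(i < size d) rho d`_i), (\poly_(i < size d) ucoef d`_i),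
  (\poly_(i < size d) vcoef d`_i).
apply/polyP => i; rewrite coef_uvpoly !coef_poly.
by case: ltnP => [_|/(nth_default 0) ->] //; case: d`_i.
Qed.

Lemma map_rho_uvpoly (F : comNzRingType) (a b c : {poly F}) :
  map_poly (@rho F) (uvpoly a b c) = a.
Proof. by apply/polyP => i; rewrite coef_map coef_uvpoly. Qed.

Lemma uvpolyD (F : comNzRingType) (a b c a' b' c' : {poly F}) :
  uvpoly a b c + uvpoly a' b' c' = uvpoly (a + a') (b + b') (c + c').
Proof. by apply/polyP => i; rewrite coefD !coef_uvpoly !coefD. Qed.

Lemma uvpolyB (F : comNzRingType) (a b c a' b' c' : {poly F}) :
  uvpoly a b c - uvpoly a' b' c' = uvpoly (a - a') (b - b') (c - c').
Proof. by apply/polyP => i; rewrite coefB !coef_uvpoly !coefB. Qed.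

Lemma uvpolyM (F : comNzRingType) (a b c a' b' c' : {poly F}) :
  uvpoly a b c * uvpoly a' b' c' =
  uvpoly (a * a') (a * b' + b * a') (a * c' + c * a').
Proof.
rewrite /uvpoly /polyR !rmorphD !rmorphM /= -!mul_polyC.
have uu : (@Ru F)%:P * Ru%:P = 0 by rewrite -polyCM Ru_sqr.
have vv : (@Rv F)%:P * Rv%:P = 0 by rewrite -polyCM Rv_sqr.
have uv : (@Ru F)%:P * Rv%:P = 0 by rewrite -polyCM Ru_Rv.
(* With the images and the constants [u], [v] turned into variables, the identity holds in any
   commutative ring modulo the three relations, which are passed to [ring]. *)
move: (map_poly _ a) (map_poly _ b) (map_poly _ c) (map_poly _ a')
  (map_poly _ b') (map_poly _ c') Ru%:P Rv%:P uu vv uv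
  => A B C A' B' C' u v uu vv uv.
by ring : uu vv uv.
Qed.

Lemma uvpoly_Xn_sub_1 (F : comNzRingType) n :
  uvpoly ('X^n - 1 : {poly F}) 0 0 = 'X^n - 1.
Proof.
rewrite /uvpoly /polyR !rmorph0 !scaler0 !addr0.
by rewrite rmorphB rmorph1 /= map_polyXn.
Qed.

(** * Ideals of F[x] and reduction modulo x^n - 1 *)

(** Euclidean descent: if [h] fails to divide some [q] in [I], then [q %% h] is a smaller nonzero
    element of [I]. As [I] is an arbitrary predicate, the case split is classical. *)
Lemma poly_ideal_principal (F : fieldType) (I : {poly F} -> Prop) (h : {poly F}) :
    (forall r x y, I x -> I y -> I (r * x + y)) -> I h -> h != 0 ->
  exists2 g, I g & forall q, I q -> g %| q.
Proof.
move=> I_lin; have [n] := ubnP (size h); elim: n h => // n IHn h sh Ih h0.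
have [hI|] := classic (forall q, I q -> h %| q); first by exists h.
move=> /not_all_ex_not nh; case: nh => q nh.
have [Iq /negP hq] := imply_to_and _ _ nh.
apply: (IHn (q %% h)) => //.
- by rewrite -ltnS (leq_trans _ sh) // ltnS ltn_modp.
- suff -> : q %% h = - (q %/ h) * h + q by exact: I_lin.
  by rewrite {3}(divp_eq q h) mulNr addKr.
Qed.

(** When [n] is invertible in [F], x^n - 1 is separable, so its complementary factors share no
    root. *)
Lemma coprime_Xn_sub_1_factors (F : fieldType) n (s g : {poly F}) :
  n%:R != 0 :> F -> 'X^n - 1 = s * g -> coprimep s g.
Proof.
move=> n0 sg; apply: (separable_coprime (separable_Xn_sub_1 n0)).
by rewrite sg.
Qed.

Lemma in_qpoly_Xn_sub_1 (A : comNzRingType) n : (0 < n)%N ->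
  in_qpoly ('X^n - 1 : {poly A}) ('X^n - 1) = 0.
Proof.
(* [mk_monic] keeps a modulus only if it is monic and nonconstant; here [0 < n] ensures the
   latter. *)
move=> n0; apply: val_inj; rewrite /= /mk_monic size_Xn_sub_1 // ltnS n0.
by rewrite monic_Xn_sub_1 //= Pdiv.RingMonic.rmodpp ?monic_Xn_sub_1.
Qed.

(** Multiplication by x sends the last entry to degree n, and x^n = 1 brings it back to degree 0;
    the difference is that entry times x^n - 1. *)
Lemma in_qpoly_shift (A : comNzRingType) n (r : 'rV[A]_n) : (0 < n)%N ->
  in_qpoly ('X^n - 1 : {poly A}) (rVpoly (\row_j r 0 (ord_pred j))) =
  in_qpoly ('X^n - 1) ('X * rVpoly r).
Proof.
case: n r => // n r _.
suff -> : 'X * rVpoly r = rVpoly (\row_j r 0 (ord_pred j)) +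
    (r 0 ord_max)%:P * ('X^(n.+1) - 1).
  by rewrite rmorphD rmorphM /= in_qpoly_Xn_sub_1 // mulr0 addr0.
apply/polyP=> k; rewrite coefD coefCM coefB coefXn coef1 coefXM.
have coefr (w : 'rV[A]_n.+1) i :
    (rVpoly w)`_i = if (i < n.+1)%N then w 0 (inord i) else 0.
  case: ltnP => [ik|?]; last by rewrite nth_default // (leq_trans (size_poly _ _)).
  by rewrite -(coef_rVpoly_ord w) inordK.

rewrite !coefr; case: k => [|k] /=.
  rewrite mxE sub0r mulrN1.
  apply/esym/eqP; rewrite subr_eq0; apply/eqP; congr (r _ _).
  by apply: val_inj; rewrite /= inordK // modn_small.
rewrite subr0 eqSS; case: (ltngtP k n) => [kn|kn|->].
- rewrite ltnS (ltnW kn) ltnS kn mxE mulr0 addr0; congr (r _ _).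
  apply: val_inj; rewrite /= !inordK ?ltnS ?(ltnW kn) // addSn /=.
  by rewrite modnDr modn_small // ltnS ltnW.
- by rewrite !ltnS leqNgt kn ltnNge ltnW //= mulr0 addr0.
- rewrite ltnSn ltnn mulr1 add0r; congr (r _ _).
  by apply: val_inj; rewrite /= inordK.
Qed.

(** * Submodules and spans *)

Section Submodules.
Variables (A : nzRingType) (V : lmodType A).

(** A [Prop] predicate, so that codes and spans, both given by existentials, are treated alike. *)
Definition submodule (N : V -> Prop) : Prop :=
  N 0 /\ forall c x y, N x -> N y -> N (c *: x + y).

Lemma submoduleD (N : V -> Prop) : submodule N ->
  forall x y, N x -> N y -> N (x + y).
Proof. by case=> _ N_lin x y Nx Ny; rewrite -[x]scale1r; apply: N_lin. Qed.

Lemma submoduleZ (N : V -> Prop) : submodule N ->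
  forall c x, N x -> N (c *: x).
Proof. by case=> N0 N_lin c x Nx; rewrite -[_ *: _]addr0; apply: N_lin. Qed.

Lemma submoduleB (N : V -> Prop) : submodule N ->
  forall x y, N x -> N y -> N (x - y).
Proof. by case=> _ N_lin x y Nx Ny; rewrite addrC -scaleN1r; apply: N_lin. Qed.

Lemma submodule_in_span (gs : seq V) : submodule (in_span gs).
Proof.
split; first by exists (fun=> 0); rewrite big1 // => i _; rewrite scale0r.
move=> c _ _ [x ->] [y ->]; exists (fun i => c * x i + y i).
rewrite scaler_sumr -big_split; apply: eq_bigr => i _ /=.
by rewrite scalerDl scalerA.
Qed.

Lemma in_span_nth (gs : seq V) i : (i < size gs)%N -> in_span gs gs`_i.
Proof.
move=> lti; exists (fun j => (j == Ordinal lti)%:R).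
rewrite (bigD1 (Ordinal lti)) //= eqxx scale1r big1 ?addr0 // => j /negPf ->.
by rewrite scale0r.
Qed.

Lemma in_span_min (N : V -> Prop) (gs : seq V) : submodule N ->
  (forall i, (i < size gs)%N -> N gs`_i) -> forall m, in_span gs m -> N m.
Proof.
move=> [N0 N_lin] Ngs _ [c ->].
by elim/big_rec: _ => // i x _ Nx; apply: N_lin => //; apply: Ngs.
Qed.

End Submodules.

(** * Cyclic codes as submodules of R_{alpha,beta} *)

Section Codes.
Variables (p alpha beta : nat).
Hypotheses (alpha_gt0 : (0 < alpha)%N) (beta_gt0 : (0 < beta)%N).
Local Notation Rab := (Rab p alpha beta).
Local Notation pair := (@inRab p alpha beta).
Implicit Types (C : {set word p alpha beta}) (c f : {poly 'F_p}).

Definition code_poly C (m : Rab) : Prop := exists2 w, w \in C & m = word_poly w.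

Lemma inRabZ (gamma : {poly Ruv 'F_p}) c d :
  gamma *: pair c d = pair (map_poly (@rho 'F_p) gamma * c) (gamma * d).
Proof. by rewrite /inRab !rmorphM. Qed.

Lemma inRabD c d c' d' : pair c d + pair c' d' = pair (c + c') (d + d').
Proof. by rewrite /inRab !rmorphD. Qed.

Lemma inRabB c d c' d' : pair c d - pair c' d' = pair (c - c') (d - d').
Proof. by rewrite /inRab !rmorphB. Qed.

Lemma inRab00 : pair 0 0 = 0.
Proof. by rewrite /inRab !rmorph0. Qed.

Lemma inRab_Xn_sub_1l c : pair (c * ('X^alpha - 1)) 0 = 0.
Proof.
by rewrite /inRab rmorphM /= in_qpoly_Xn_sub_1 // mulr0 rmorph0.
Qed.

Lemma inRab_Xn_sub_1r d : pair 0 (d * ('X^beta - 1)) = 0.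
Proof.
by rewrite /inRab rmorphM /= in_qpoly_Xn_sub_1 // mulr0 rmorph0.
Qed.

Lemma word_polyD : {morph @word_poly p alpha beta : w w' / w + w'}.
Proof. by move=> w w'; rewrite /word_poly inRabD -!raddfD. Qed.

Lemma word_polyZ (z : Ruv 'F_p) (w : word p alpha beta) :
  word_poly (z *: w) = z%:P *: word_poly w.
Proof.
by rewrite /word_poly inRabZ map_polyC /= !mul_polyC -!linearZ.
Qed.

Lemma word_poly_shift (w : word p alpha beta) :
  word_poly (shift w) = 'X *: word_poly w.
Proof.
by rewrite /word_poly inRabZ map_polyX /inRab !in_qpoly_shift.
Qed.

Lemma submodule_code_poly C : additive_cyclic C -> submodule (code_poly C).
Proof.
case=> -[C0 C_lin] C_shift.
have N0 : code_poly C 0 by exists 0 => //; rewrite /word_poly !raddf0 inRab00.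
have ND x y : code_poly C x -> code_poly C y -> code_poly C (x + y).
  case=> w Cw -> [w' Cw' ->]; exists (w + w'); last by rewrite word_polyD.
  by rewrite -[w]scale1r C_lin.
split=> // gamma x y Nx Ny; apply: (ND) => //.
(* Horner induction on the scalar: x acts as the shift, and constants act through the scaling of
   words. *)
elim/poly_ind: gamma => [|gamma z IH]; first by rewrite scale0r.
rewrite scalerDl; apply: ND.
  case: IH => w Cw IH; exists (shift w); first exact: C_shift.
  by rewrite word_poly_shift -IH scalerA mulrC.
case: Nx => w Cw ->; exists (z *: w); last by rewrite word_polyZ.
by rewrite -[z *: w]addr0 C_lin.
Qed.

Lemma generated_by_intro C gs : additive_cyclic C ->
    (forall i, (i < size gs)%N -> code_poly C gs`_i) ->
    (forall m, code_poly C m -> in_span gs m) ->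
  generated_by C gs.
Proof.
move=> Ccyc Cgs Cspan m; split; first exact: Cspan.
exact: in_span_min (submodule_code_poly Ccyc) Cgs _.
Qed.

(** * Elements by components, and the layers of a submodule *)

Lemma inRab_surj (m : Rab) : exists c d0 d1 d2, m = pair c (uvpoly d0 d1 d2).
Proof.
case: m => c d; have [d0 [d1 [d2 Dd]]] := uvpoly_surj (d : {poly Ruv 'F_p}).
exists c, d0, d1, d2; rewrite -Dd /inRab.
(* An element of the quotient is stored as a reduced polynomial, which represents it. *)
by congr (_, _); apply/val_inj/esym/in_qpoly_small/size_mk_monic.
Qed.

Lemma inRab_lin r c c' x y z x' y' z' :
  uvpoly r 0 0 *: pair c (uvpoly x y z) + pair c' (uvpoly x' y' z') =
  pair (r * c + c') (uvpoly (r * x + x') (r * y + y') (r * z + z')).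
Proof.
by rewrite inRabZ map_rho_uvpoly inRabD uvpolyM uvpolyD !mul0r !addr0.
Qed.

Lemma inRabM r s t c x y z :
  uvpoly r s t *: pair c (uvpoly x y z) =
  pair (r * c) (uvpoly (r * x) (r * y + s * x) (r * z + t * x)).
Proof. by rewrite inRabZ map_rho_uvpoly uvpolyM. Qed.

Lemma inRab_Xn_sub_1_uvpoly x y z :
  pair 0 (uvpoly (x * ('X^beta - 1)) (y * ('X^beta - 1)) (z * ('X^beta - 1))) = 0.
Proof.
rewrite -(inRab_Xn_sub_1r (uvpoly x y z)) -uvpoly_Xn_sub_1 uvpolyM.
by rewrite !mulr0 !add0r.
Qed.

Lemma uvpoly0 (F : comNzRingType) : uvpoly (0 : {poly F}) 0 0 = 0.
Proof. by rewrite /uvpoly /polyR rmorph0 !scaler0 !addr0. Qed.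

Lemma Xn_sub_1_neq0 (F : nzRingType) n : (0 < n)%N -> 'X^n - 1 != 0 :> {poly F}.
Proof. by move=> n0; rewrite monic_neq0 ?monic_Xn_sub_1. Qed.

(** Only divisibility is recorded. Which elements lie above [f1], [g], [a], [b] is left open, so
    that different generating families can be tested against the same layers. *)
Record layered (N : Rab -> Prop) f1 g a b : Prop := Layered {
  layered_alpha c : N (pair c 0) -> f1 %| c;
  layered_rho c x y z : N (pair c (uvpoly x y z)) -> g %| x;
  layered_u c y z : N (pair c (uvpoly 0 y z)) -> a %| y;
  layered_v c z : N (pair c (uvpoly 0 0 z)) -> b %| z
}.

(** Arbitrary representatives are allowed, so x^n - 1, representing 0, lies in each ideal of leading
    coefficients; the ideal is thus nonzero and has a generator dividing x^n - 1. *)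
Lemma submodule_generators (N : Rab -> Prop) : submodule N ->
  exists f1 f2 f3 f4 g a b p1 p2 p3 : {poly 'F_p},
    [/\ [/\ a %| g, b %| g, g %| 'X^beta - 1 & f1 %| 'X^alpha - 1],
        layered N f1 g a b,
        N (pair f1 0) /\ N (pair f2 (uvpoly g p1 p2)) &
        N (pair f3 (uvpoly 0 a p3)) /\ N (pair f4 (uvpoly 0 0 b))].
Proof.
move=> Nsub; have [N0 N_lin] := Nsub.
have hb0 := @Xn_sub_1_neq0 'F_p _ beta_gt0.
have ha0 := @Xn_sub_1_neq0 'F_p _ alpha_gt0.
have [||f1 Nf1 f1P] := @poly_ideal_principal _ (fun c => N (pair c 0)) _ _ _ ha0.
- move=> r x y Nx Ny; rewrite -uvpoly0.
  have := N_lin (uvpoly r 0 0) _ _ Nx Ny.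
  by rewrite -uvpoly0 inRab_lin !mulr0 !addr0.
- by have := inRab_Xn_sub_1l 1; rewrite mul1r => ->.
have [||g [f2 [p1 [p2 Ng]]] gP] := @poly_ideal_principal _
  (fun x => exists c y z, N (pair c (uvpoly x y z))) _ _ _ hb0.
- move=> r x x' [c [y [z Nx]]] [c' [y' [z' Nx']]].
  exists (r * c + c'), (r * y + y'), (r * z + z').
  by rewrite -inRab_lin; apply: N_lin.
- exists 0, 0, 0; have := inRab_Xn_sub_1_uvpoly 1 0 0.
  by rewrite mul1r !mul0r => ->.
have [||a [f3 [p3 Na]] aP] := @poly_ideal_principal _
  (fun y => exists c z, N (pair c (uvpoly 0 y z))) _ _ _ hb0.
- move=> r y y' [c [z Ny]] [c' [z' Ny']].
  exists (r * c + c'), (r * z + z').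
  by have := N_lin (uvpoly r 0 0) _ _ Ny Ny'; rewrite inRab_lin mulr0 addr0.
- exists 0, 0; have := inRab_Xn_sub_1_uvpoly 0 1 0.
  by rewrite mul1r !mul0r => ->.
have [||b [f4 Nb] bP] := @poly_ideal_principal _
  (fun z => exists c, N (pair c (uvpoly 0 0 z))) _ _ _ hb0.
- move=> r z z' [c Nz] [c' Nz'].
  exists (r * c + c').
  by have := N_lin (uvpoly r 0 0) _ _ Nz Nz'; rewrite inRab_lin !mulr0 !addr0.
- exists 0; have := inRab_Xn_sub_1_uvpoly 0 0 1.
  by rewrite mul1r !mul0r => ->.
exists f1, f2, f3, f4, g, a, b, p1, p2, p3; split=> //.
- split.
  + apply: aP; exists 0, 0; have := submoduleZ Nsub (uvpoly 0 1 0) Ng.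
    by rewrite inRabM !mul0r mul1r !add0r.
  + apply: bP; exists 0; have := submoduleZ Nsub (uvpoly 0 0 1) Ng.
    by rewrite inRabM !mul0r mul1r !add0r.
  + apply: gP; exists 0, 0, 0; have := inRab_Xn_sub_1_uvpoly 1 0 0.
    by rewrite mul1r !mul0r => ->.
  + by apply: f1P; have := inRab_Xn_sub_1l 1; rewrite mul1r => ->.
- split=> [|c x y z Nx|c y z Ny|c z Nz]; first exact: f1P.
  + by apply: gP; exists c, y, z.
  + by apply: aP; exists c, z.
  + by apply: bP; exists c.
Qed.

(* Subtracting a multiple of each generator in turn clears one layer of
   [m]: first its residue mod [(u, v)], then [u], then [v]. *)
Lemma layered_sub (N S : Rab -> Prop) f1 f2 f3 f4 g a b p1 p2 p3 :
    submodule N -> submodule S -> layered N f1 g a b ->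
    (forall m, S m -> N m) ->
    S (pair f1 0) -> S (pair f2 (uvpoly g p1 p2)) ->
    S (pair f3 (uvpoly 0 a p3)) -> S (pair f4 (uvpoly 0 0 b)) ->
  forall m, N m -> S m.
Proof.
move=> Nsub Ssub [f1P gP aP bP] SN Sf Sg Sa Sb m.
(* The difference is still in [N] because [S] lies in [N]; this is handed on, since the next layer
   needs it to find its quotient. *)
have subtract q c x y z c' x' y' z' :
    S (pair c' (uvpoly x' y' z')) ->
    (N (pair (c - q * c') (uvpoly (x - q * x') (y - q * y') (z - q * z'))) ->
     S (pair (c - q * c') (uvpoly (x - q * x') (y - q * y') (z - q * z')))) ->
    N (pair c (uvpoly x y z)) -> S (pair c (uvpoly x y z)).
  move=> S' imp Nm.
  have Dm : pair (c - q * c') (uvpoly (x - q * x') (y - q * y') (z - q * z')) =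
      pair c (uvpoly x y z) - uvpoly q 0 0 *: pair c' (uvpoly x' y' z').
    by rewrite inRabM !mul0r !addr0 inRabB uvpolyB.
  have Sq := submoduleZ Ssub (uvpoly q 0 0) S'.
  rewrite -[pair c _](subrK (uvpoly q 0 0 *: pair c' (uvpoly x' y' z'))).
  apply: submoduleD => //; rewrite -Dm; apply: imp; rewrite Dm.
  by apply: submoduleB => //; apply: SN.
have [c [x [y [z ->]]]] := inRab_surj m => Nm.
have /dvdpP[q Dx] := gP _ _ _ _ Nm; subst x.
move: Nm; apply: (subtract q) Sg _; rewrite subrr.
move: (c - _) (y - _) (z - _) => {}c {}y {}z Nm.
have /dvdpP[r Dy] := aP _ _ _ Nm; subst y.
move: Nm; apply: (subtract r) Sa _; rewrite subrr mulr0 subr0.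
move: (c - _) (z - _) => {}c {}z Nm.
have /dvdpP[s Dz] := bP _ _ Nm; subst z.
move: Nm; apply: (subtract s) Sb _; rewrite subrr !mulr0 !subr0 uvpoly0.
move: (c - _) => {}c Nm.
have /dvdpP[t ->] := f1P _ Nm.
have := submoduleZ Ssub (uvpoly t 0 0) Sf.
by rewrite inRabZ map_rho_uvpoly mulr0.
Qed.

(* [r s] is idempotent modulo [X^beta - 1] and kills [g], and [t g = 1 - r s] is
   absorbed since [(ux + vy) g = (ux + vy)(g + ux + vy)]. *)
Lemma submodule_nilpotent_part (N : Rab -> Prop) f g x y r s t :
    submodule N -> 'X^beta - 1 = s * g -> r * s + t * g = 1 ->
    N (pair f (uvpoly g x y)) ->
  N (pair (r * s * f) (uvpoly 0 x y)).
Proof.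
(* The multiplier is rs + t(ux + vy): its two terms contribute rs(ux + vy) and tg(ux + vy), with sum
   ux + vy. *)
move=> Nsub sg bez /(submoduleZ Nsub (uvpoly (r * s) (t * x) (t * y))).
rewrite inRabM; congr N.
have -> : r * s * x + t * x * g = x by rewrite -[RHS]mul1r -bez; ring.
have -> : r * s * y + t * y * g = y by rewrite -[RHS]mul1r -bez; ring.
(* What remains is rsg = r(x^beta - 1), which is zero in the quotient. *)
rewrite -[RHS]addr0 -(inRab_Xn_sub_1_uvpoly r 0 0) inRabD uvpolyD.
by rewrite !mul0r !addr0 add0r sg mulrA.
Qed.

End Codes.

(** * Generators of a cyclic code *)

Theorem theorem5 (p alpha beta : nat) (p_prime : prime p)
    (alpha_gt0 : (0 < alpha)%N) (beta_gt0 : (0 < beta)%N)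
    (C : {set word p alpha beta}) (C_cyclic : additive_cyclic C) :
  (~~ coprime beta p ->
     (exists f1 f2 f3 f4 g a b p1 p2 p3 : {poly 'F_p},
        [/\ a %| g, b %| g, g %| 'X^beta - 1, f1 %| 'X^alpha - 1 &
            generated_by C
              [:: inRab alpha beta f1 0;
                  inRab alpha beta f2 (polyR g + Ru *: polyR p1 + Rv *: polyR p2);
                  inRab alpha beta f3 (Ru *: polyR a + Rv *: polyR p3);
                  inRab alpha beta f4 (Rv *: polyR b)]])
  \/ (exists f1 f2 g p1 p2 : {poly 'F_p},
        [/\ exists q : {poly Ruv 'F_p},
              'X^beta - 1 = q * (polyR g + Ru *: polyR p1 + Rv *: polyR p2),
            f1 %| 'X^alpha - 1 &
            generated_by C
              [:: inRab alpha beta f1 0;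
                  inRab alpha beta f2
                    (polyR g + Ru *: polyR p1 + Rv *: polyR p2)]]))
  /\
  (coprime beta p ->
     exists f1 f2 f3 g a b p1 : {poly 'F_p},
       [/\ a %| g, b %| g, g %| 'X^beta - 1, f1 %| 'X^alpha - 1 &
           generated_by C
             [:: inRab alpha beta f1 0;
                 inRab alpha beta f2 (polyR g + Ru *: polyR a + Rv *: polyR p1);
                 inRab alpha beta f3 (Rv *: polyR b)]]).
Proof.
have Nsub := submodule_code_poly alpha_gt0 beta_gt0 C_cyclic.
have [f1 [f2 [f3 [f4 [g [a [b [p1 [p2 [p3]]]]]]]]]] :=
  submodule_generators alpha_gt0 beta_gt0 Nsub.
case=> -[ag bg gh f1h] layN [Nf1 Ng] [Na Nb].
have uE (x y : {poly 'F_p}) : Ru *: polyR x + Rv *: polyR y = uvpoly 0 x y.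
  by rewrite /uvpoly /polyR rmorph0 add0r.
have vE (x : {poly 'F_p}) : Rv *: polyR x = uvpoly 0 0 x.
  by rewrite /uvpoly /polyR rmorph0 scaler0 !add0r.
split=> [_|cop].
  left; exists f1, f2, f3, f4, g, a, b, p1, p2, p3; split=> //.
  rewrite -/(uvpoly g p1 p2) uE vE.
  set gs := [:: _; _; _; _].
  have Ngs i : (i < size gs)%N -> code_poly C gs`_i
    by rewrite {}/gs; case: i => [|[|[|[|i]]]].
  apply: generated_by_intro => //.
  have Ssub := submodule_in_span gs.
  apply: (layered_sub Nsub Ssub layN).
  - exact: in_span_min.
  - exact: (@in_span_nth _ _ gs 0).
  - exact: (@in_span_nth _ _ gs 1).
  - exact: (@in_span_nth _ _ gs 2).
  - exact: (@in_span_nth _ _ gs 3).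
have /dvdpP[s sg] := gh.
have betaF : beta%:R != 0 :> 'F_p.
  by rewrite -(dvdn_pcharf (pchar_Fp p_prime)) -prime_coprime // coprime_sym.
have /Bezout_eq1_coprimepP[[r t] /= bez] := coprime_Xn_sub_1_factors betaF sg.
(* Removing the nilpotent part [(r s f2, u p1 + v p2)] from the element above [g] leaves second
   component [g]; then [(f3, u a + v p3)] is added. *)
pose f := f2 - r * s * f2 + f3.
have Ne : code_poly C (inRab alpha beta f (uvpoly g a p3)).
  have Nn := submodule_nilpotent_part beta_gt0 Nsub sg bez Ng.
  have := submoduleD Nsub (submoduleB Nsub Ng Nn) Na.
  by rewrite inRabB inRabD uvpolyB uvpolyD subr0 addr0 !subrr !add0r.
exists f1, f, f4, g, a, b, p3; split=> //.
rewrite -/(uvpoly g a p3) vE.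
set gs := [:: _; _; _].
have Ngs i : (i < size gs)%N -> code_poly C gs`_i
    by rewrite {}/gs; case: i => [|[|[|i]]] /=.
apply: generated_by_intro => //.
have Ssub := submodule_in_span gs.
have Se : in_span gs (inRab alpha beta f (uvpoly g a p3)).
  exact: (@in_span_nth _ _ gs 1).
apply: (layered_sub Nsub Ssub layN _ _ Se).
- exact: in_span_min.
- exact: (@in_span_nth _ _ gs 0).
(* Inside the span, the nilpotent part [(r s f, u a + v p3)] of the merged generator supplies the
   element above [a]. *)
- exact: submodule_nilpotent_part sg bez Se.
- exact: (@in_span_nth _ _ gs 2).
Qed.
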